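(* For every fixed integer $r\ge 2$, \[ \frac{z_{\mathcal{R}^{(r)}}(\mathbb{RM}^{(r)}_{n})}{n}\longrightarrow \frac{(r-1)!}{r^{r-1}}\quad\text{in probability as } n\to\infty . \] Equivalently, the size of a largest $r$-partite sub-matching of $\mathbb{RM}^{(r)}_{n}$ is asymptotic (in probability) to $\frac{(r-1)!}{r^{r-1}}n$.
   Context: An ordered $r$-matching of size $n$ is a set of $n$ pairwise disjoint $r$-element subsets (edges) of a linearly ordered vertex set of size $rn$, with no other vertices; $\mathcal{M}^{(r)}_n$ denotes the set of all ordered $r$-matchings on $[rn]$, and $\mathbb{RM}^{(r)}_n$ denotes a matching chosen uniformly at random from $\mathcal{M}^{(r)}_n$. An ordered matching can be written as a word: each edge gets a letter, and each vertex is replaced by the letter of its edge. An $r$-pattern is an ordered $r$-matching of size 2, written as a word over $\{A,B\}$ with each letter appearing $r$ times and beginning with $A$. Two disjoint edges $e,f$ of an ordered matching form the pattern $P$ if the matching $\{e,f\}$ (with the induced order) is order-isomorphic to $P$. For a set $\mathcal{P}$ of $r$-patterns, a $\mathcal{P}$-clique is an ordered $r$-matching in which every pair of edges forms a pattern belonging to $\mathcal{P}$; $z_{\mathcal{P}}(M)$ is the largest size of a $\mathcal{P}$-clique contained in $M$ (as a sub-matching). An $r$-pattern is $r$-partite if it is of the form $S_1S_2\cdots S_r$ with each $S_i\in\{AB,BA\}$ (and $S_1=AB$); $\mathcal{R}^{(r)}$ denotes the set of all $2^{r-1}$ $r$-partite $r$-patterns. An ordered $r$-matching of size $m$ is $r$-partite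 if each edge contains exactly one vertex from each of the $r$ consecutive blocks of $m$ vertices. *)

(* Defs.v *)
From HB Require Import structures.
From mathcomp Require Import all_boot all_order all_algebra.
Set Implicit Arguments. Unset Strict Implicit. Unset Printing Implicit Defensive.
Import Order.TTheory GRing.Theory Num.Theory.

(* Ordered r-matchings of size n on [rn]: partitions of [rn] into r-element
   edges (necessarily n of them). *)
Definition matchings (r n : nat) : {set {set {set 'I_(r * n)}}} :=
  [set M | partition M [set: 'I_(r * n)] && [forall e in M, #|e| == r]].

Definition letA := true.
Definition letB := false.

(* The word (pattern) of a pair of disjoint edges e, f: list the vertices of
   e :|: f in increasing order; a vertex gets letter A iff it lies in the same
   edge as the smallest vertex, so that the word begins with A. *)
Definition pattern_word (N : nat) (e f : {set 'I_N}) : seq bool :=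
  let u := sort (fun x y : 'I_N => (x <= y)%N) (enum (e :|: f)) in
  match u with
  | [::] => [::]
  | y :: _ => [seq (x \in e) == (y \in e) | x <- u]
  end.

(* The set R^(r) of r-partite r-patterns: words S_1 S_2 ... S_r with each
   S_i in {AB, BA} and S_1 = AB.  A tuple entry b = true encodes S_i = AB. *)
Definition rpartite_pattern (r : nat) : pred (seq bool) :=
  fun w => [exists S : (r.-1).-tuple bool,
    w == flatten [seq (if b then [:: letA; letB] else [:: letB; letA])
                 | b <- true :: (S : seq bool)]].

Definition is_clique (N : nat) (P : pred (seq bool)) (C : {set {set 'I_N}}) : bool :=
  [forall e in C, forall f in C, (e != f) ==> P (pattern_word e f)].

Definition zP (N : nat) (P : pred (seq bool)) (M : {set {set 'I_N}}) : nat :=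
  \max_(C : {set {set 'I_N}} | (C \subset M) && is_clique P C) #|C|.

From mathcomp Require Import all_classical all_reals all_analysis.

(* Main.v *)
(* A clique for the r-partite patterns is cut by r - 1 thresholds into r blocks
   that each contain exactly one vertex of every edge, and conversely the edges
   of M that are transversal to a partition into r intervals form a clique. So
   z(M) is the maximum over cuts of the number of edges of M transversal to the
   cut. For a fixed cut with block sizes b_1, ..., b_r this number has mean
   n * (b_1 * ... * b_r) / C(rn, r), which by AM-GM is largest for the balanced
   cut, where it is asymptotic to n * (r - 1)! / r ^ (r - 1). Since moving the
   thresholds by at most n / K each spoils at most (r - 1)(n / K + 1) edges, it
   suffices to control a number of cuts bounded independently of n, and for each
   of them Chebyshev's inequality applies: by symmetry under relabelling the
   vertices, all pairs of disjoint r-sets are equally likely to be both edges of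
   M, and the variance is o(n ^ 2). *)
Require Import Defs.
From HB Require Import structures.
From mathcomp Require Import all_boot all_order all_algebra all_fingroup.
From mathcomp Require Import zify ring lra.
Set Implicit Arguments. Unset Strict Implicit. Unset Printing Implicit Defensive.
Import Order.TTheory GRing.Theory Num.Theory.

(** * Patterns and ranks *)

(** Neighbouring letters may agree across pairs: the word is cut into [m] pairs of two distinct
    letters, so [ABBA] qualifies. Unlike [rpartite_pattern], this form is invariant under exchanging
    the letters. *)
Definition alternating (m : nat) (a : seq bool) : Prop :=
  size a = m.*2 /\ forall k, k < m -> nth false a k.*2.+1 = ~~ nth false a k.*2.

Definition letter_pair (b : bool) := if b then [:: letA; letB] else [:: letB; letA].

Lemma alternating_flatten m (a : seq bool) :
  alternating m a <-> exists2 s, size s = m & a = flatten (map letter_pair s).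
Proof.
elim: m a => [|m IH] a; split.
- by case=> /size0nil -> _; exists [::].
- by case=> s /size0nil -> ->; split.
- case: a => [|x [|y a]] [//=] [sa] alt.
  have /IH[s ss ea] : alternating m a.
    by split=> // k lt_km; apply: (alt k.+1).
  exists (x :: s) => /=; first by rewrite ss.
  by rewrite -ea; have /= -> := alt 0 isT; case: (x).
case=> [] [//|b s] [ss] ->.
have [sa alt] : alternating m (flatten (map letter_pair s)) by apply/IH; exists s.
split=> [|[_|k lt_km]]; first by case: (b) => /=; rewrite sa.
  by case: (b).
by case: (b) => /=; apply: alt.
Qed.

Lemma rpartite_patternP r (w : seq bool) :
  reflect (alternating r.+1 w /\ nth false w 0) (rpartite_pattern r.+1 w).
Proof.
apply: (iffP existsP) => [[S /eqP ->]|[/alternating_flatten[[//|b s] [ss] ->]]].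
  split=> //; apply/alternating_flatten; exists (true :: S) => //=.
  by rewrite size_tuple.
case: b => // _; exists (tcast ss (in_tuple s)).
by apply/eqP; rewrite /= val_tcast.
Qed.

Section Rank.
Variable N : nat.
Implicit Types (e f S : {set 'I_N}) (x y : 'I_N).

Definition rank e x := #|[set y in e | y < x]|.

Definition increasing_enum S := sort (fun x y : 'I_N => x <= y) (enum S).

Lemma mem_increasing_enum S : increasing_enum S =i S.
Proof. by move=> x; rewrite mem_sort mem_enum. Qed.

Lemma size_increasing_enum S : size (increasing_enum S) = #|S|.
Proof. by rewrite size_sort -cardE. Qed.

Lemma uniq_increasing_enum S : uniq (increasing_enum S).
Proof. by rewrite sort_uniq enum_uniq. Qed.

Lemma sorted_increasing_enum S :
  sorted (fun x y : 'I_N => x < y) (increasing_enum S).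
Proof.
have := @sort_lt_sorted _ 'I_N (enum S); rewrite enum_uniq.
by apply: etrans; congr sorted.
Qed.

Lemma filter_increasing_enum S x : x \in S ->
  [seq y : 'I_N <- increasing_enum S | y < x]
  = take (index x (increasing_enum S)) (increasing_enum S).
Proof.
move=> xS; have xu : x \in increasing_enum S by rewrite mem_increasing_enum.
rewrite -[in RHS](@filter_lt_nth _ 'I_N x).
- by rewrite nth_index.
- exact: sorted_increasing_enum.
- by rewrite index_mem.
Qed.

Lemma rankE e S x : e \subset S -> x \in S ->
  rank e x
  = count (mem e) (take (index x (increasing_enum S)) (increasing_enum S)).
Proof.
move=> /subsetP eS xS; rewrite -filter_increasing_enum // -size_filter -filter_predI.
rewrite /rank cardE.
apply/perm_size/uniq_perm; rewrite ?enum_uniq ?filter_uniq ?uniq_increasing_enum //.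
move=> y; rewrite mem_enum inE mem_filter mem_increasing_enum /=.
by case ye: (y \in e) => //=; rewrite (eS _ ye) andbT.
Qed.

Lemma rank_index S x : x \in S -> rank S x = index x (increasing_enum S).
Proof.
move=> xS; rewrite (@rankE S S) //.
set u := increasing_enum S.
have lt_xu : index x u < size u by rewrite index_mem mem_increasing_enum.
rewrite -[RHS](size_takel (ltnW lt_xu)); apply/eqP; rewrite -all_count.
by apply/allP => y /mem_take; rewrite mem_increasing_enum.
Qed.

Lemma leq_rank e x y : x <= y -> rank e x <= rank e y.
Proof.
move=> le_xy; apply/subset_leq_card/subsetP => z; rewrite !inE => /andP[-> /=].
by move/leq_trans; apply.
Qed.

Lemma rank_lt_card e x : x \in e -> rank e x < #|e|.
Proof.
move=> xe; apply/proper_card/properP; split.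
  by apply/subsetP => y; rewrite inE => /andP[].
by exists x; rewrite // inE ltnn andbF.
Qed.

Lemma rank_inj e : {in e &, injective (rank e)}.
Proof.
move=> x y xe ye; rewrite !rank_index // => /(congr1 (nth x (increasing_enum e))).
by rewrite !nth_index ?mem_increasing_enum.
Qed.

End Rank.

Lemma count_take_alternating (m k : nat) (a : seq bool) : alternating m a -> k <= m ->
  count id (take k.*2 a) = k.
Proof.
case=> sa alt; elim: k => [|k IH] lt_km; first by rewrite take0.
rewrite doubleS (take_nth false) ?(take_nth false) -?cats1; try lia.
rewrite !count_cat IH ?(ltnW lt_km) //= alt //.
by case: nth => /=; rewrite ?addn0 ?add0n ?addn1.
Qed.

Lemma alternating_negb m a : alternating m a -> alternating m (map negb a).
Proof.
case=> sa alt; split=> [|k lt_km]; first by rewrite size_map.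
by rewrite !(nth_map false) ?alt //; lia.
Qed.

(** Each full pair before [x] holds exactly one vertex of [e], so the rank of [x] is the zero-based
    number of its pair. *)
Lemma alternating_rank N (e S : {set 'I_N}) m x :
    e \subset S -> alternating m [seq y \in e | y <- increasing_enum S] ->
  x \in e -> rank e x = (index x (increasing_enum S))./2.
Proof.
set u := increasing_enum S => eS alt xe.
have xu : x \in u by rewrite mem_increasing_enum (subsetP eS).
rewrite (rankE eS (subsetP eS x xe)) -/u; set j := index x u.
have ju : j < size u by rewrite index_mem.
have [sa al] := alt; rewrite size_map in sa.
have eq_count k : count (mem e) (take k u) = count id (take k [seq y \in e | y <- u]).
  by rewrite -map_take count_map; apply: eq_count => y.
have lt_jm : j./2 < m by rewrite ltn_half_double -sa.
have ej := odd_double_half j; move: (j./2) lt_jm ej => k lt_km.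
case: (odd j) => /= ej; last first.
  by rewrite -ej add0n eq_count (count_take_alternating alt) // ltnW.
have lt_ku : k.*2 < size u by rewrite (leq_trans _ ju) // -ej add1n ltnS.
rewrite -ej add1n (take_nth x) // -cats1 count_cat /= eq_count.
rewrite (count_take_alternating alt) ?(ltnW lt_km) //.
(* At an odd position the partner of [x] precedes it; since [x] lies in [e], the partner does not,
   and the count is unchanged. *)
have := al _ lt_km; rewrite -[_.+1]add1n ej !(nth_map x) //.
by rewrite nth_index // xe => /esym/negbTE ->; rewrite !addn0.
Qed.

Lemma mem_disjointU (T : finType) (e f : {set T}) x :
  [disjoint e & f] -> x \in e :|: f -> (x \in f) = (x \notin e).
Proof.
move=> dis; rewrite inE; case xe: (x \in e) => //= _.
exact: disjointFr dis xe.
Qed.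

Lemma card_sepU (T : finType) (P : pred T) (e f : {set T}) : [disjoint e & f] ->
  #|[set x in e :|: f | P x]| = #|[set x in e | P x]| + #|[set x in f | P x]|.
Proof.
move=> dis; rewrite -cardsUI.
rewrite (_ : _ :&: _ = set0) ?cards0 ?addn0; last first.
  apply/setP => y; rewrite !inE; case ye: (y \in e) => //=.
  by rewrite (disjointFr dis ye) andbF.
by apply: eq_card => y; rewrite !inE andb_orl.
Qed.

Lemma card_ord_lt r k : k <= r -> #|[set i : 'I_r | i < k]| = k.
Proof. by move=> le_kr; rewrite -sum1dep_card (big_ord_narrow le_kr) sum1_card card_ord. Qed.

Section Patterns.
Variables (N r : nat).
Implicit Types (e f : {set 'I_N}) (x y : 'I_N).

(** The pattern word is normalised to begin with A, so its letters record membership in [e] or its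
    negation; pairs of distinct letters survive both readings. *)
Lemma rpartite_wordP e f : [disjoint e & f] ->
  rpartite_pattern r.+1 (pattern_word e f)
  <-> alternating r.+1 [seq y \in e | y <- increasing_enum (e :|: f)].
Proof.
move=> dis; rewrite /pattern_word -/(increasing_enum _).
case: (increasing_enum _) => [|y u]; first by split=> [/rpartite_patternP|] [[]].
apply: (iff_trans (iff_sym (rwP (rpartite_patternP _ _)))).
have -> : nth false [seq (x \in e) == (y \in e) | x <- y :: u] 0 by rewrite /= eqxx.
set b := [seq x \in e | x <- y :: u].
have -> : [seq (x \in e) == (y \in e) | x <- y :: u] = [seq v == (y \in e) | v <- b].
  by rewrite -map_comp.
case: (y \in e).
  by rewrite (eq_map eqb_id) map_id; split=> [[]|].
rewrite (eq_map eqbF_neg); split=> [[/alternating_negb]|/alternating_negb //].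
by rewrite (mapK negbK).
Qed.

(** Apply [alternating_rank] to [e] and, with letters exchanged, to [f]: ranks number the pairs of
    the word, and a smaller rank means an earlier pair. *)
Lemma rpartite_rank_lt e f x y : [disjoint e & f] ->
    rpartite_pattern r.+1 (pattern_word e f) ->
  x \in e -> y \in f -> rank e x < rank f y -> x < y.
Proof.
move=> dis /(rpartite_wordP dis) alt xe yf.
rewrite (alternating_rank (subsetUl e f) alt xe).
rewrite (alternating_rank (m := r.+1) (subsetUr e f) _ yf); last first.
  have := alternating_negb alt; rewrite -map_comp; congr alternating.
  apply/eq_in_map => z; rewrite mem_increasing_enum => zS.
  by rewrite /= (mem_disjointU dis zS).
have xS : x \in e :|: f by rewrite inE xe.
have yS : y \in e :|: f by rewrite inE yf orbT.
rewrite -!rank_index // => lt_half; rewrite ltnNge; apply: contraTN lt_half => le_yx.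
by rewrite -leqNgt half_leq // leq_rank.
Qed.

End Patterns.

(** * Transversals of a vertex colouring *)

Definition transversals (N r : nat) (c : 'I_N -> 'I_r) : {set {set 'I_N}} :=
  [set e : {set 'I_N} | (#|e| == r) && (c @: e == setT)].

Section Transversals.
Variables (N r : nat) (c : 'I_N -> 'I_r).
Implicit Types (e f : {set 'I_N}) (x y : 'I_N).

Lemma transversal_inj e : e \in transversals c -> {in e &, injective c}.
Proof.
rewrite inE => /andP[/eqP card_e /eqP im_e]; apply/imset_injP.
by rewrite im_e cardsT card_ord card_e.
Qed.

Lemma card_transversal_lt e k : e \in transversals c -> k <= r ->
  #|[set y in e | c y < k]| = k.
Proof.
move=> eT le_kr; rewrite -[RHS](card_ord_lt le_kr) -(card_in_imset (f := c)).
  have := eT; rewrite inE => /andP[_ /eqP im_e].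
  apply: eq_card => i; rewrite inE; apply/imsetP/idP => [[y]|lt_ik].
    by rewrite inE => /andP[_ lt_yk] ->.
  have /imsetP[y ye eq_i] : i \in c @: e by rewrite im_e inE.
  by exists y => //; rewrite inE ye -eq_i.
move=> x y; rewrite !inE => /andP[xe _] /andP[ye _]; exact: (transversal_inj eT xe ye).
Qed.

Hypothesis c_homo : forall x y, x <= y -> c x <= c y.

(** Each transversal has [k] vertices of colour below [k], so [e :|: f] has [2k] of them. As colours
    are monotone, colour [k] occupies exactly the positions [2k] and [2k + 1]. *)
Lemma transversal_index e f x : e \in transversals c -> f \in transversals c ->
    [disjoint e & f] -> x \in e :|: f ->
  (index x (increasing_enum (e :|: f)))./2 = c x.
Proof.
move=> eT fT dis xS; rewrite -rank_index //.
have card_lt k : k <= r -> #|[set y in e :|: f | c y < k]| = k.*2.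
  by move=> le_kr; rewrite card_sepU // !card_transversal_lt // addnn.
apply/eqP; rewrite eqn_leq -ltnS ltn_half_double -card_lt ?ltn_ord //.
rewrite geq_half_double -card_lt ?(ltnW (ltn_ord _)) //; apply/andP; split.
  apply/proper_card/properP; split.
    apply/subsetP => y; rewrite !inE => /andP[-> /= /ltnW].
    by rewrite ltnS; apply: c_homo.
  by exists x; rewrite inE ?ltnn ?andbF // xS ltnS leqnn.
apply/subset_leq_card/subsetP => y; rewrite !inE => /andP[-> /=].
by apply: contraTT; rewrite -!leqNgt; apply: c_homo.
Qed.

End Transversals.

(** Positions [2k] and [2k + 1] share a colour, and a transversal uses each colour only once, so the
    two vertices come from different edges. *)
Lemma transversal_rpartite N r (c : 'I_N -> 'I_r.+1) (e f : {set 'I_N}) :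
    (forall x y : 'I_N, x <= y -> c x <= c y) ->
    e \in transversals c -> f \in transversals c -> [disjoint e & f] ->
  rpartite_pattern r.+1 (pattern_word e f).
Proof.
move=> c_homo eT fT dis; apply/(rpartite_wordP _ dis).
have card_S : #|e :|: f| = r.+1.*2.
  move: (eT) (fT); rewrite !inE => /andP[/eqP ce _] /andP[/eqP cf _].
  by rewrite cardsU (disjoint_setI0 dis) cards0 subn0 ce cf addnn.
set u := increasing_enum (e :|: f).
have su : size u = r.+1.*2 by rewrite size_increasing_enum.
split=> [|k lt_kr]; first by rewrite size_map.
have lt1 : k.*2.+1 < size u by rewrite su -doubleS leq_double.
have lt0 : k.*2 < size u := ltnW lt1.
have [x0 _] : exists x, x \in u.
  by case: (u) lt0 => // x ? _; exists x; rewrite mem_head.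
rewrite !(nth_map x0) //.
set y := nth x0 u k.*2; set z := nth x0 u _.
have yS : y \in e :|: f by rewrite -mem_increasing_enum mem_nth.
have zS : z \in e :|: f by rewrite -mem_increasing_enum mem_nth.
have eq_c : c y = c z.
  apply: val_inj => /=; rewrite -!(transversal_index c_homo eT fT dis) // -/u.
  rewrite !index_uniq ?uniq_increasing_enum //.
  by rewrite doubleK /= uphalf_double.
have neq_yz : y != z by rewrite nth_uniq ?uniq_increasing_enum // neq_ltn leqnn.
case ye: (y \in e); case ze: (z \in e) => //; case/eqP: neq_yz.
  exact: (transversal_inj eT) eq_c.
by apply: (transversal_inj fT) eq_c; rewrite (mem_disjointU dis) // ?ye ?ze.
Qed.

(** * Cliques and cuts *)

(** The lower bound half: the transversal edges of [M] themselves form a clique. *)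
Lemma card_transversals_leq_zP N r (c : 'I_N -> 'I_r.+1) (M : {set {set 'I_N}}) :
    trivIset M -> (forall x y : 'I_N, x <= y -> c x <= c y) ->
  #|M :&: transversals c| <= zP (rpartite_pattern r.+1) M.
Proof.
move=> /trivIsetP triv c_homo.
apply: (@leq_bigmax_cond _ _ (fun C : {set {set 'I_N}} => #|C|)).
rewrite subsetIl /=; apply/forall_inP => e /setIP[eM eT].
apply/forall_inP => f /setIP[fM fT]; apply/implyP => neq_ef.
by apply: (transversal_rpartite c_homo) => //; apply: triv.
Qed.

Lemma card_threshold_le N r (q : 'I_r -> nat) (x : 'I_N) :
  #|[set i | q i <= x]| < r.+1.
Proof. by rewrite ltnS -[leqRHS]card_ord max_card. Qed.

(** Counting the thresholds at or below [x] gives a monotone colouring even when [q] is not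
    sorted. *)
Definition threshold_coloring N r (q : 'I_r -> nat) (x : 'I_N) : 'I_r.+1 :=
  Ordinal (card_threshold_le q x).

Lemma card_ord_itv N a b : #|[set x : 'I_N | a <= x < b]| <= b - a.
Proof.
rewrite -(size_iota a (b - a)) cardE -(size_map val).
apply: uniq_leq_size; first by rewrite map_inj_uniq ?enum_uniq //; exact: val_inj.
by move=> _ /mapP[x + ->]; rewrite mem_enum inE mem_iota /=; lia.
Qed.

(** Every edge meeting [B] is the [pblock] of some point of [B]. *)
Lemma leq_card_meeting (T : finType) (C : {set {set T}}) (B : {set T}) :
  trivIset C -> #|[set e in C | e :&: B != set0]| <= #|B|.
Proof.
move=> triv; apply: leq_trans (leq_imset_card (pblock C) B).
apply/subset_leq_card/subsetP => e; rewrite inE => /andP[eC /set0Pn[x /setIP[xe xB]]].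
by apply/imsetP; exists x; rewrite // (def_pblock triv eC xe).
Qed.

Lemma leq_card_bigcup (I T : finType) (F : I -> {set T}) :
  (#|\bigcup_i F i| <= \sum_i #|F i|)%N.
Proof.
elim/big_ind2: _ => [|m A m' A' leA leA'|//]; first by rewrite cards0.
by rewrite (leq_trans (leq_card_setU _ _)) // leq_add.
Qed.

Section Clique.
Variables (N r : nat) (C : {set {set 'I_N}}).
Hypotheses (triv : trivIset C) (card_edge : forall e, e \in C -> #|e| = r.+1).
Hypothesis cliqueC : is_clique (rpartite_pattern r.+1) C.

(* The position of the cut that separates, in every edge of the clique, the
   vertices of rank at most [i] from the later ones. *)
Definition clique_threshold (i : 'I_r) : nat :=
  \max_(e in C) \max_(x in e | rank e x <= i) x.+1.

Lemma clique_threshold_le i : clique_threshold i <= N.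
Proof. by apply/bigmax_leqP => e _; apply/bigmax_leqP. Qed.

(** Vertices of rank at most [i] in any edge precede those of rank above [i] in any edge: by
    monotonicity of [rank] inside one edge, by [rpartite_rank_lt] across two. *)
Lemma clique_threshold_leP e x i : e \in C -> x \in e ->
  (clique_threshold i <= x) = (i < rank e x).
Proof.
move=> eC xe; apply/idP/idP => [|lt_ix].
  apply: contraTT; rewrite -leqNgt -ltnNge => le_xi.
  apply: leq_trans (leq_bigmax_cond _ eC).
  by apply: (@leq_bigmax_cond _ _ (fun y : 'I_N => y.+1)); rewrite xe.
apply/bigmax_leqP => f fC; apply/bigmax_leqP => y /andP[yf le_yi].
have lt_rank := leq_ltn_trans le_yi lt_ix.
have [eq_fe|neq_fe] := eqVneq f e.
  rewrite eq_fe in lt_rank; rewrite ltnNge; apply: contraTN lt_rank.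
  by rewrite -leqNgt; apply: leq_rank.
have dis : [disjoint f & e] by move/trivIsetP: triv; apply.
have /forall_inP/(_ f fC)/forall_inP/(_ e eC)/implyP/(_ neq_fe) rp := cliqueC.
exact: (rpartite_rank_lt dis rp).
Qed.

(** On an edge avoiding [B], the colour of a vertex equals its rank, and the ranks in an edge are
    distinct. *)
Lemma clique_transversals (q : 'I_r -> nat) (B : {set 'I_N}) e :
    (forall x i, x \notin B -> (q i <= x) = (clique_threshold i <= x)) ->
    e \in C -> e :&: B = set0 ->
  e \in transversals (threshold_coloring q).
Proof.
move=> qE eC eB.
have colE x : x \in e -> threshold_coloring q x = rank e x :> nat.
  move=> xe; have xB : x \notin B.
    by apply: contra_eqN eB => xB; apply/set0Pn; exists x; rewrite inE xe.
  have le_rank : rank e x <= r by rewrite -ltnS -(card_edge eC) rank_lt_card.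
  rewrite -[RHS](card_ord_lt le_rank).
  by apply: eq_card => i; rewrite !inE qE // (clique_threshold_leP _ eC xe).
rewrite inE card_edge // eqxx /= eqEcard subsetT cardsT card_ord.
rewrite card_in_imset ?card_edge ?leqnn // => x y xe ye eq_c.
by apply: (rank_inj xe ye); rewrite -!colE // eq_c.
Qed.

(* Rounding the thresholds of the clique down to multiples of [L] changes the
   colour of at most [r * L] vertices, hence spoils at most that many edges. *)
Lemma clique_leq_grid Q L : 0 < L -> N < Q * L ->
  exists q : {ffun 'I_r -> 'I_Q},
    #|C| <= #|C :&: transversals (@threshold_coloring N r (fun i => q i * L))| + r * L.
Proof.
move=> L_gt0 ltNQL.
have qP i : clique_threshold i %/ L < Q.
  by rewrite ltn_divLR // (leq_ltn_trans (clique_threshold_le i)).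
exists [ffun i => Ordinal (qP i)].
set c := threshold_coloring _.
(* Only vertices between a threshold and its rounded value can be counted differently; each of the
   [r] gaps has fewer than [L] of them. *)
pose B := \bigcup_(i < r)
  [set x : 'I_N | clique_threshold i %/ L * L <= x < clique_threshold i].
have cardB : #|B| <= r * L.
  apply: leq_trans (_ : \sum_(i < r) L <= _); last by rewrite sum_nat_const card_ord.
  apply: leq_trans (leq_card_bigcup _) _; apply: leq_sum => i _.
  apply: leq_trans (card_ord_itv _ _ _) _.
  by rewrite leq_subLR {1}(divn_eq (clique_threshold i) L) leq_add2l ltnW ?ltn_mod.
apply: leq_trans (leq_add (leqnn _) (leq_trans (leq_card_meeting B triv) cardB)).
apply: leq_trans (leq_card_setU _ _); apply/subset_leq_card/subsetP => e eC.
rewrite in_setU in_setI [X in _ || X]inE eC /=.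
have [eB|] := eqVneq (e :&: B) set0; last by rewrite orbT.
rewrite orbF; apply: clique_transversals eC eB => x i xB; rewrite ffunE /=.
apply/idP/idP => [le_x|]; last by apply: leq_trans; exact: leq_trunc_div.
rewrite leqNgt; apply: contra xB => lt_x; apply/bigcupP; exists i => //.
by rewrite inE le_x.
Qed.

End Clique.

(** * Symmetry and moments *)

(** List [T] as [e], then [f], then the rest, and likewise for [e'] and [f']; the permutation
    matches the two lists position by position. *)
Lemma exists_perm_pair (T : finType) (e f e' f' : {set T}) :
    [disjoint e & f] -> [disjoint e' & f'] -> #|e| = #|e'| -> #|f| = #|f'| ->
  exists s : {perm T}, s @: e = e' /\ s @: f = f'.
Proof.
move=> dis dis' ce cf.
pose ord (a b : {set T}) := enum a ++ enum b ++ enum (~: (a :|: b)).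
have mem_ord (a b : {set T}) x : x \in ord a b.
  by rewrite !mem_cat !mem_enum inE in_setU; case: (x \in a); case: (x \in b).
have uniq_ord (a b : {set T}) : [disjoint a & b] -> uniq (ord a b).
  move=> dab; rewrite !cat_uniq !enum_uniq /= andbT; apply/andP; split.
    apply/hasPn => x; rewrite mem_cat !mem_enum in_setC in_setU /=.
    by case xa: (x \in a) => //=; rewrite (disjointFr dab xa).
  apply/hasPn => x; rewrite !mem_enum in_setC in_setU /=.
  by case: (x \in b); rewrite ?orbT.
have size_ord (a b : {set T}) : [disjoint a & b] -> size (ord a b) = #|T|.
  move=> dab; rewrite -(card_uniqP (uniq_ord a b dab)).
  by apply: eq_card => x; rewrite mem_ord.
pose s x := nth x (ord e' f') (index x (ord e f)).
have lt_index x : index x (ord e f) < size (ord e' f').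
  by rewrite size_ord // -(size_ord _ _ dis) index_mem.
have s_inj : injective s.
  move=> x y; rewrite /s (set_nth_default x y) // => /eqP.
  rewrite nth_uniq ?uniq_ord // => /eqP/(congr1 (nth x (ord e f))).
  by rewrite !nth_index.
exists (perm s_inj); split; apply/eqP; rewrite eqEcard card_imset ?ce ?cf ?leqnn ?andbT;
  try exact: perm_inj; apply/subsetP => _ /imsetP[x xe ->]; rewrite permE /s.
  rewrite index_cat mem_enum xe nth_cat -cardE -ce cardE index_mem mem_enum xe.
  by rewrite -mem_enum mem_nth // -cardE -ce cardE index_mem mem_enum.
rewrite index_cat mem_enum (disjointFl dis xe) nth_cat -!cardE ce ltnNge leq_addr /=.
rewrite addKn index_cat mem_enum xe nth_cat -cardE -cf cardE index_mem mem_enum xe.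
by rewrite -mem_enum mem_nth // -cardE -cf cardE index_mem mem_enum.
Qed.

Lemma sum_card_swap (I J : finType) (R : I -> J -> bool) (S : {set I}) (A : {set J}) :
  \sum_(j in A) #|[set i in S | R i j]| = \sum_(i in S) #|[set j in A | R i j]|.
Proof.
under eq_bigr => j _ do rewrite -sum1dep_card big_mkcondr.
rewrite exchange_big /=; apply: eq_bigr => i _.
by rewrite -big_mkcondr /= sum1dep_card.
Qed.

(** When all elements of [U] have the same degree into [A], incidences with [S] and with [U] are in
    the ratio of the cardinals. It serves below with [A] the matchings and [U] all [r]-sets or all
    disjoint pairs of them. *)
Lemma uniform_double_count (I J : finType) (R : I -> J -> bool) (S U : {set I})
    (A : {set J}) :
    S \subset U ->
    {in U &, forall i i', #|[set j in A | R i j]| = #|[set j in A | R i' j]|} ->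
  #|U| * \sum_(j in A) #|[set i in S | R i j]|
  = #|S| * \sum_(j in A) #|[set i in U | R i j]|.
Proof.
move=> /subsetP sSU unif; rewrite [in LHS]sum_card_swap [in RHS]sum_card_swap.
have [->|[i0 /sSU i0U]] := set_0Vmem S; first by rewrite big_set0 cards0 muln0.
have sumE (V : {set I}) : {subset V <= U} ->
    \sum_(i in V) #|[set j in A | R i j]| = #|V| * #|[set j in A | R i0 j]|.
  by move=> sVU; rewrite -sum_nat_const; apply: eq_bigr => i /sVU iU; exact: (unif _ _ iU i0U).
by rewrite !sumE // mulnCA.
Qed.

Section Matchings.
Variables r n : nat.
Notation N := (r * n).
Notation edge := {set 'I_N}.
Implicit Types (e f : edge) (M T : {set edge}).

Definition relabel (s : {perm 'I_N}) M : {set edge} := [set s @: (e : edge) | e in M].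

Lemma relabel_matchings s M : M \in matchings r n -> relabel s M \in matchings r n.
Proof.
rewrite !inE => /andP[partM /forall_inP cardM]; apply/andP; split.
  have <- : s @: [set: 'I_N] = [set: 'I_N].
    by apply/eqP; rewrite eqEcard subsetT card_imset ?leqnn //; exact: perm_inj.
  by rewrite /relabel imset_partition //; exact: perm_inj.
apply/forall_inP => _ /imsetP[e eM ->].
by rewrite card_imset ?cardM //; exact: perm_inj.
Qed.

Lemma relabel_inj s : injective (relabel s).
Proof. by apply: imset_inj; apply: imset_inj; exact: perm_inj. Qed.

Lemma card_matchings_relabel (s : {perm 'I_N}) e f :
  #|[set M in matchings r n | (e \in M) && (f \in M)]|
  <= #|[set M in matchings r n | (s @: e \in M) && (s @: f \in M)]|.
Proof.
rewrite -(card_imset _ (@relabel_inj s)).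
apply/subset_leq_card/subsetP => _ /imsetP[M + ->].
by rewrite inE => /and3P[MM eM fM]; rewrite inE relabel_matchings //= !imset_f.
Qed.

Lemma card_matchings_pair e f e' f' :
    [disjoint e & f] -> [disjoint e' & f'] -> #|e| = #|e'| -> #|f| = #|f'| ->
  #|[set M in matchings r n | (e \in M) && (f \in M)]|
  = #|[set M in matchings r n | (e' \in M) && (f' \in M)]|.
Proof.
move=> dis dis' ce cf; apply/eqP; rewrite eqn_leq; apply/andP; split.
  by have [s [<- <-]] := exists_perm_pair dis dis' ce cf; exact: card_matchings_relabel.
have [s [<- <-]] := exists_perm_pair dis' dis (esym ce) (esym cf).
exact: card_matchings_relabel.
Qed.

Lemma card_matchings_edge e f : #|e| = #|f| ->
  #|[set M in matchings r n | e \in M]| = #|[set M in matchings r n | f \in M]|.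
Proof.
have leE e1 e2 : #|e1| = #|e2| ->
    #|[set M in matchings r n | e1 \in M]| <= #|[set M in matchings r n | e2 \in M]|.
  (* A single edge is treated as a pair whose second member is empty. *)
  move=> c12; have dis0 (e0 : edge) : [disjoint e0 & set0 : edge].
    by rewrite -setI_eq0 setI0.
  have [s [<- _]] := exists_perm_pair (dis0 e1) (dis0 e2) c12 erefl.
  have := card_matchings_relabel s e1 e1.
  by congr (_ <= _); apply: eq_card => M; rewrite inE [RHS]inE andbb.
by move=> cef; apply/eqP; rewrite eqn_leq !leE.
Qed.

Lemma matching_card_edge M e : M \in matchings r n -> e \in M -> #|e| = r.
Proof. by rewrite inE => /andP[_ /forall_inP cardM] /cardM/eqP. Qed.

Lemma matching_trivIset M : M \in matchings r n -> trivIset M.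
Proof. by rewrite inE => /andP[/and3P[]]. Qed.

Hypothesis r_gt0 : 0 < r.

Lemma card_matching M : M \in matchings r n -> #|M| = n.
Proof.
move=> MM; have := MM; rewrite inE => /andP[partM _].
have := card_uniform_partition (fun e => @matching_card_edge M e MM) partM.
by rewrite cardsT card_ord [RHS]mulnC => /eqP; rewrite eqn_pmul2l // => /eqP.
Qed.

Definition rsets : {set edge} := [set e : edge | #|e| == r].

Lemma card_rsets : #|rsets| = 'C(N, r).
Proof. by rewrite card_draws card_ord. Qed.

(** First moment, cleared of denominators: compare [T] with the family of all [r]-sets, which meets
    every matching in [n] edges. *)
Lemma sum_card_inter T : T \subset rsets ->
  'C(N, r) * \sum_(M in matchings r n) #|M :&: T| = #|T| * (n * #|matchings r n|).
Proof.
move=> sT.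
have sepE M T' : M :&: T' = [set e in T' | e \in M].
  by apply/setP => e; rewrite !inE andbC.
under eq_bigr => M _ do rewrite sepE.
rewrite -card_rsets (@uniform_double_count _ _ (fun e M => e \in M) T rsets) //.
  congr (_ * _); rewrite [RHS]mulnC -sum_nat_const; apply: eq_bigr => M MM.
  rewrite -[RHS](card_matching MM); apply: eq_card => e; rewrite !inE andbC.
  by case eM: (e \in M) => //; rewrite (matching_card_edge MM eM) eqxx.
by move=> e f; rewrite !inE => /eqP ce /eqP cf; apply: card_matchings_edge; rewrite ce cf.
Qed.

Definition disjoint_pairs T : {set edge * edge} :=
  [set p : edge * edge | [&& p.1 \in T, p.2 \in T & [disjoint p.1 & p.2]]].

Lemma card_disjoint_pairs_rsets : #|disjoint_pairs rsets| = 'C(N, r) * 'C(N - r, r).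
Proof.
rewrite -card_rsets -sum_nat_const -sum1dep_card.
rewrite -(pair_big_dep (fun e => e \in rsets)
            (fun e f => (f \in rsets) && [disjoint e & f]) (fun _ _ => 1%N)) /=.
apply: eq_bigr => e; rewrite inE => /eqP ce.
rewrite sum1dep_card -[N in 'C(N - r, r)]card_ord -cardsT -[in X in 'C(_ - X, r)]ce.
rewrite -cardsDS ?subsetT // setTD -cards_draws.
by apply: eq_card => f; rewrite !inE andbC disjoint_sym disjoints_subset.
Qed.

Lemma leq_card_disjoint_pairs T : #|disjoint_pairs T| <= #|T| ^ 2.
Proof.
rewrite -mulnn -cardsX; apply/subset_leq_card/subsetP => p.
by rewrite !inE => /and3P[-> ->].
Qed.

Lemma card_matching_pairs M T : M \in matchings r n -> T \subset rsets ->
  #|[set p in disjoint_pairs T | (p.1 \in M) && (p.2 \in M)]|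
  = #|M :&: T| * #|M :&: T|.-1.
Proof.
move=> MM sT; rewrite -sum_nat_const -sum1dep_card.
transitivity (\sum_(e in M :&: T) \sum_(f in (M :&: T) :\ e) 1); last first.
  by apply: eq_bigr => e eMT; rewrite sum1_card (cardsD1 e (M :&: T)) eMT.
rewrite pair_big_dep /=; apply: eq_bigl => -[e f] /=; rewrite !inE /=.
case eM: (e \in M); rewrite ?andbF //; case fM: (f \in M); rewrite ?andbF //= !andbT.
case: (e \in T); case: (f \in T); rewrite ?andbF //= andbT.
(* An edge is not disjoint from itself because [r > 0] makes it nonempty. *)
have [->|neq_fe] := eqVneq f e.
  rewrite -setI_eq0 setIid -cards_eq0 (matching_card_edge MM eM).
  by rewrite eqn0Ngt r_gt0.
have /trivIsetP := matching_trivIset MM; apply=> //.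
by rewrite eq_sym.
Qed.

(** Second factorial moment, counting ordered pairs of distinct edges. It is only an inequality
    because the disjoint pairs in [T] are bounded by all pairs. *)
Lemma sum_card_inter_pairs T : T \subset rsets ->
  'C(N, r) * 'C(N - r, r) * \sum_(M in matchings r n) (#|M :&: T| * #|M :&: T|.-1)
  <= #|T| ^ 2 * (n * n.-1 * #|matchings r n|).
Proof.
move=> sT.
under eq_bigr => M MM do rewrite -(card_matching_pairs MM sT).
rewrite -card_disjoint_pairs_rsets.
rewrite (@uniform_double_count _ _ (fun p M => (p.1 \in M) && (p.2 \in M))
           (disjoint_pairs T) (disjoint_pairs rsets)).
- apply: leq_mul; first exact: leq_card_disjoint_pairs.
  rewrite [leqRHS]mulnC -sum_nat_const; apply: leq_sum => M MM.
  rewrite card_matching_pairs // (setIidPl _) ?card_matching //.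
  by apply/subsetP => e eM; rewrite inE (matching_card_edge MM eM).
- apply/subsetP => p; rewrite !inE => /and3P[/(subsetP sT) + /(subsetP sT) + ->].
  by rewrite !inE => -> ->.
move=> [e f] [e' f']; rewrite !inE /= => /and3P[/eqP ce /eqP cf dis].
move=> /and3P[/eqP ce' /eqP cf' dis'].
by apply: card_matchings_pair => //; rewrite ?ce ?cf ?ce' ?cf'.
Qed.

End Matchings.

(** * Counting transversals: AM-GM and the balanced cut *)

Lemma card_transversals N r (c : 'I_N -> 'I_r) :
  #|transversals c| = \prod_(i < r) #|[set x | c x == i]|.
Proof.
(* Transversals are the images of the functions in [family F], which choose one vertex in each
   colour class. *)
pose F (i : 'I_r) : pred 'I_N := [pred x | c x == i].
pose im (g : {ffun 'I_r -> 'I_N}) : {set 'I_N} := g @: setT.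
have cg g i : g \in family F -> c (g i) = i by move=> /familyP/(_ i)/eqP.
have -> : \prod_(i < r) #|[set x | c x == i]| = #|family F|.
  rewrite card_family foldrE big_map big_enum /=.
  by apply: eq_bigr => i _; apply: eq_card => x; rewrite !inE.
rewrite -(card_in_imset (f := im)) => [|g h gF hF eq_im]; last first.
  apply/ffunP => i; have : g i \in im h by rewrite -eq_im imset_f.
  by case/imsetP => j _ eq_gh; rewrite eq_gh -(cg g i gF) eq_gh (cg h j hF).
apply: eq_card => e; rewrite inE; apply/andP/imsetP => [[/eqP ce /eqP im_e]|[g gF ->]].
  have /fin_all_exists2[g ge gc] (i : 'I_r) : exists2 x, x \in e & i = c x.
    by apply/imsetP; rewrite im_e inE.
  exists (finfun g); first by apply/familyP => i; rewrite ffunE inE -gc.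
  apply/esym/eqP; rewrite eqEcard ce; apply/andP; split.
    by apply/subsetP => _ /imsetP[i _ ->]; rewrite ffunE.
  rewrite card_imset ?cardsT ?card_ord // => i j; rewrite !ffunE => eq_g.
  by rewrite (gc i) (gc j) eq_g.
split.
  rewrite card_imset ?cardsT ?card_ord // => i j eq_g.
  by rewrite -(cg g i gF) -(cg g j gF) eq_g.
rewrite eqEsubset subsetT; apply/subsetP => i _; apply/imsetP.
by exists (g i); rewrite ?imset_f ?cg.
Qed.

Section AMGM.
Local Open Scope ring_scope.

Lemma leq_prod_of_sum r n (a : 'I_r -> nat) :
  (\sum_i a i = r * n)%N -> (\prod_i a i <= n ^ r)%N.
Proof.
case: r a => [|r] a sum_a; first by rewrite big_ord0.
rewrite -(ler_nat rat) natr_prod natrX.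
have [le_prod _] :=
  leif_AGM (A := 'I_r.+1) (E := fun i => (a i)%:R : rat) (fun _ _ => ler0n _ _).
apply: le_trans le_prod _.
by rewrite card_ord -natr_sum sum_a natrM [_ * n%:R]mulrC mulfK ?pnatr_eq0.
Qed.

End AMGM.

Lemma leq_card_transversals r n (c : 'I_(r * n) -> 'I_r) : #|transversals c| <= n ^ r.
Proof.
rewrite card_transversals; apply: leq_prod_of_sum.
rewrite -[RHS]card_ord -sum1_card (partition_big c predT) //=.
by apply: eq_bigr => i _; rewrite sum1dep_card.
Qed.

Lemma ltn_block r n (x : 'I_(r.+1 * n)) : x %/ n < r.+1.
Proof. by case: n x => [|n] x; rewrite ?divn0 // ltn_divLR. Qed.

Definition block_coloring r n (x : 'I_(r.+1 * n)) : 'I_r.+1 := Ordinal (ltn_block x).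

(** Equality in the AM-GM bound: the class of colour [i] contains the [n] vertices [i * n + j]. *)
Lemma card_block_transversals r n :
  #|transversals (@block_coloring r n)| = n ^ r.+1.
Proof.
apply/eqP; rewrite eqn_leq leq_card_transversals card_transversals.
rewrite -[X in X <= _]/(n ^ r.+1) -[X in n ^ X <= _]card_ord -prod_nat_const.
apply: leq_prod => i _.
have lt_ij (j : 'I_n) : i * n + j < r.+1 * n.
  apply: (@leq_trans (i.+1 * n)); first by rewrite mulSn addnC ltn_add2r.
  by rewrite leq_mul2r ltn_ord orbT.
rewrite -[X in X <= _](card_ord n) -cardsT.
rewrite -(card_imset (f := fun j => Ordinal (lt_ij j))) => [|j k /(congr1 val)/addnI/val_inj //].
apply/subset_leq_card/subsetP => _ /imsetP[j _ ->]; rewrite inE -val_eqE /=.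
by rewrite divnMDl ?divn_small ?addn0 // (leq_ltn_trans _ (ltn_ord j)).
Qed.

Lemma transversals_rsets r n (c : 'I_(r * n) -> 'I_r) : transversals c \subset rsets r n.
Proof. by apply/subsetP => e; rewrite !inE => /andP[]. Qed.

Lemma zP_leq_grid r n Q L (M : {set {set 'I_(r.+1 * n)}}) :
    M \in matchings r.+1 n -> 0 < L -> r.+1 * n < Q * L ->
  exists q : {ffun 'I_r -> 'I_Q},
    zP (rpartite_pattern r.+1) M
    <= #|M :&: transversals (@threshold_coloring (r.+1 * n) r (fun i => q i * L))| + r * L.
Proof.
move=> MM L_gt0 ltQL.
have [|C /andP[sCM cliqueC] zE] := @eq_bigmax_cond _
  [pred C : {set {set 'I_(r.+1 * n)}} | (C \subset M) && is_clique (rpartite_pattern r.+1) C]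
  (fun C => #|C|).
  (* The empty clique shows that the maximum ranges over a nonempty family, hence is attained. *)
  apply/card_gt0P; exists set0; rewrite inE sub0set; apply/forall_inP => e.
  by rewrite inE.
have [q leC] := clique_leq_grid (trivIsetS sCM (matching_trivIset MM))
  (fun e eC => matching_card_edge MM (subsetP sCM e eC)) cliqueC L_gt0 ltQL.
exists q; rewrite /zP zE; apply: leq_trans leC _.
by rewrite leq_add2r subset_leq_card // setSI.
Qed.

(** * Variance bound and Chebyshev's inequality *)

Section SecondMoment.
Local Open Scope ring_scope.
Variable R : realFieldType.

Lemma chebyshev_count (I : finType) (A : {set I}) (X : I -> R) (mu d : R) : 0 <= d ->
  #|[set x in A | d < `|X x - mu|]|%:R * d ^+ 2 <= \sum_(x in A) (X x - mu) ^+ 2.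
Proof.
move=> d_ge0; rewrite mulr_natl -sumr_const.
rewrite [leLHS](eq_bigl (fun x => (x \in A) && (d < `|X x - mu|))) => [|x]; last by rewrite inE.
rewrite big_mkcondr; apply: ler_sum => x _; case: ifP => [lt_d|_]; last exact: sqr_ge0.
by rewrite -[leRHS]real_normK ?num_real // lerXn2r ?nnegrE // ltW.
Qed.

Variables (r n : nat).
Hypotheses (r_gt0 : (0 < r)%N) (n_gt1 : (1 < n)%N).

(* Bounds the variance of [#|M :&: T|] by [n ^ 2 * deviation_rate]: the
   binomial ratio is the correlation of two disjoint edges, [1 / n] the diagonal. *)
Definition deviation_rate : R :=
  ('C(r * n, r)%:R / 'C(r * n - r, r)%:R - 1) + n%:R^-1.

Lemma deviation_rate_ge0 : 0 <= deviation_rate.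
Proof.
have B2_gt0 : 0 < 'C(r * n - r, r)%:R :> R.
  rewrite ltr0n bin_gt0 leq_subRL ?leq_pmulr // ?(ltnW n_gt1) //.
  by rewrite addnn -muln2 leq_mul2l n_gt1 orbT.
rewrite addr_ge0 ?invr_ge0 ?ler0n // subr_ge0 ler_pdivlMr // mul1r.
by rewrite ler_nat leq_bin2l // leq_subr.
Qed.

(** Expanding the square through the factorial moments [S1] and [S2] bounds the variance by
    [mu ^+ 2 * (B / B2 - 1) + mu]; then [mu <= n] is used. *)
Lemma sum_sqr_deviation (T : {set {set 'I_(r * n)}}) (mu : R) :
    T \subset rsets r n -> mu = #|T|%:R * n%:R / 'C(r * n, r)%:R ->
  \sum_(M in matchings r n) (#|M :&: T|%:R - mu) ^+ 2
  <= #|matchings r n|%:R * (n%:R ^+ 2 * deviation_rate).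
Proof.
move=> sT muE; set m : R := #|matchings r n|%:R.
set B : R := 'C(r * n, r)%:R in muE *; set B2 : R := 'C(r * n - r, r)%:R.
have n_gt0 : (0 : R) < n%:R by rewrite ltr0n ltnW.
have B_gt0 : 0 < B by rewrite ltr0n bin_gt0 leq_pmulr // ltnW.
(* Two disjoint [r]-sets fit because [n >= 2] gives [2r <= r * n]. *)
have B2_gt0 : 0 < B2.
  rewrite ltr0n bin_gt0 leq_subRL ?leq_pmulr // ?(ltnW n_gt1) //.
  by rewrite addnn -muln2 leq_mul2l n_gt1 orbT.
have leB2 : B2 <= B by rewrite ler_nat leq_bin2l // leq_subr.
have mu_ge0 : 0 <= mu by rewrite muE divr_ge0 ?mulr_ge0 ?ler0n // ltW.
have le_mu : mu <= n%:R.
  rewrite muE ler_pdivrMr // mulrC ler_pM2l // /B ler_nat -card_rsets.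
  exact: subset_leq_card.
have m_ge0 : 0 <= m by exact: ler0n.
pose S1 : R := \sum_(M in matchings r n) #|M :&: T|%:R.
pose S2 : R := \sum_(M in matchings r n) (#|M :&: T| * #|M :&: T|.-1)%:R.
have S1E : S1 = mu * m.
  have /(congr1 (fun k => k%:R : R)) := sum_card_inter r_gt0 sT.
  rewrite !natrM natr_sum -/S1 -/B -/m => eqS.
  by apply: (mulfI (lt0r_neq0 B_gt0)); rewrite eqS muE; field; exact: lt0r_neq0.
have S2_le : S2 <= mu ^+ 2 * (B / B2) * m.
  have := sum_card_inter_pairs r_gt0 sT.
  rewrite -(ler_nat R) natrM [X in _ <= X]natrM natrX !natrM natr_sum -/S2 -/B -/B2 -/m => leS.
  have le_pred : n.-1%:R <= n%:R :> R by rewrite ler_nat leq_pred.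
  rewrite -(ler_pM2l (mulr_gt0 B_gt0 B2_gt0)); apply: le_trans leS _.
  have -> : B * B2 * (mu ^+ 2 * (B / B2) * m) = #|T|%:R ^+ 2 * (n%:R * n%:R * m).
    by rewrite muE; field; rewrite !lt0r_neq0.
  by rewrite ler_wpM2l ?exprn_ge0 ?ler0n // ler_wpM2r // ler_wpM2l // ltW.
have -> : \sum_(M in matchings r n) (#|M :&: T|%:R - mu) ^+ 2
    = S2 + S1 - 2 * mu * S1 + mu ^+ 2 * m.
  rewrite /m -sum1_card natr_sum /S1 /S2 !mulr_sumr -big_split -sumrB -big_split /=.
  apply: eq_bigr => M _; case: #|_| => [|k]; rewrite ?natrM /=; first by ring.
  by rewrite -natr1; ring.
rewrite S1E.
have -> : n%:R ^+ 2 * deviation_rate = n%:R ^+ 2 * (B / B2 - 1) + n%:R.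
  by rewrite /deviation_rate -/B -/B2; field; rewrite !lt0r_neq0.
have ge1 : 0 <= B / B2 - 1 by rewrite subr_ge0 ler_pdivlMr // mul1r.
have : mu ^+ 2 * (B / B2 - 1) <= n%:R ^+ 2 * (B / B2 - 1).
  by rewrite ler_wpM2r // lerXn2r ?nnegrE // ltW.
move=> /(ler_wpM2r m_ge0) le1; have le2 := ler_wpM2r m_ge0 le_mu.
lra.
Qed.

Lemma card_deviation (T : {set {set 'I_(r * n)}}) (d : R) :
    T \subset rsets r n -> 0 < d ->
  #|[set M in matchings r n |
      d * n%:R < `|#|M :&: T|%:R - #|T|%:R * n%:R / 'C(r * n, r)%:R|]|%:R
  <= #|matchings r n|%:R * (deviation_rate / d ^+ 2).
Proof.
move=> sT d_gt0; have n_gt0 : (0 : R) < n%:R by rewrite ltr0n ltnW.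
have dn_gt0 : 0 < d * n%:R by rewrite mulr_gt0.
rewrite -(ler_pM2r (exprn_gt0 2 dn_gt0)).
apply: le_trans (chebyshev_count _ _ _ (ltW dn_gt0)) _.
apply: le_trans (sum_sqr_deviation sT erefl) _.
by rewrite exprMn le_eqVlt; apply/orP; left; apply/eqP; field; rewrite lt0r_neq0.
Qed.

End SecondMoment.

From mathcomp Require Import all_classical all_reals all_analysis.
Import numFieldNormedType.Exports.
Local Open Scope classical_set_scope.
Local Open Scope ring_scope.

(** * Asymptotics *)

Lemma cvg_ratio_mulBn (R : realType) (r k : nat) : (0 < r)%N ->
  ((r * n - k)%N%:R / n%:R : R) @[n --> \oo] --> (r%:R : R).
Proof.
move=> r_gt0.
have inv0 : (n%:R^-1 : R) @[n --> \oo] --> (0 : R).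
  by rewrite -cvg_shiftS; exact: cvg_harmonic.
have lim : (r%:R - k%:R * n%:R^-1 : R) @[n --> \oo] --> (r%:R - k%:R * 0 : R).
  by apply: cvgB; [exact: cvg_cst | apply: cvgM; [exact: cvg_cst | exact: inv0]].
rewrite mulr0 subr0 in lim; apply: cvg_trans lim; apply: near_eq_cvg; near=> n.
have n_gt0 : (0 < n)%N by near: n; exact: nbhs_infty_gt.
(* From here on the truncated subtraction is a true one. *)
have le_kn : (k <= r * n)%N.
  by apply: (@leq_trans n); [near: n; exact: nbhs_infty_ge | rewrite leq_pmull].
by rewrite natrB // natrM mulrBl mulfK // pnatr_eq0 -lt0n.
Unshelve. all: by end_near. Qed.

(** The binomial is a falling factorial over [r!]; each of its [r] factors divided by [n] tends to
    [r]. *)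
Lemma cvg_ratio_bin (R : realType) (r k : nat) :
  ('C(r * n - k, r)%:R / n%:R ^+ r : R) @[n --> \oo] --> (r%:R ^+ r / r`!%:R : R).
Proof.
have binE n : 'C(r * n - k, r)%:R / n%:R ^+ r
    = (\prod_(i < r) ((r * n - (k + i))%N%:R / n%:R)) / r`!%:R :> R.
  rewrite big_split /= prodr_const card_ord exprVn mulrAC; congr (_ / _).
  have fact_neq0 : r`!%:R != 0 :> R by rewrite pnatr_eq0 -lt0n fact_gt0.
  apply: (mulIf fact_neq0); rewrite divfK // -natrM bin_ffact ffact_prod natr_prod.
  by apply: eq_bigr => i _; rewrite subnDA.
under eq_fun => n do rewrite binE.
have -> : r%:R ^+ r / r`!%:R = (\prod_(i < r) r%:R) / r`!%:R :> R.
  by rewrite prodr_const card_ord.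
apply: cvgM; last exact: cvg_cst.
apply: cvg_big => [|i _]; first exact: mul_continuous.
exact: cvg_ratio_mulBn (leq_ltn_trans (leq0n i) (ltn_ord i)).
Qed.

Section Limits.
Variables (R : realType) (r : nat).
Hypothesis r_gt0 : (0 < r)%N.

Let lim_neq0 : r%:R ^+ r / r`!%:R != 0 :> R.
Proof.
by rewrite mulf_neq0 ?invr_eq0 ?expf_neq0 ?pnatr_eq0 -?lt0n ?fact_gt0.
Qed.

Lemma cvg_density :
  (n%:R ^+ r / 'C(r * n, r)%:R : R) @[n --> \oo] --> (r.-1`!%:R / (r ^ r.-1)%:R : R).
Proof.
(* The limit is rewritten as the inverse of [r ^ r / r!], the limit of the inverse sequence. *)
have -> : r.-1`!%:R / (r ^ r.-1)%:R = (r%:R ^+ r / r`!%:R)^-1 :> R.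
  case: r r_gt0 => // s _; rewrite factS natrM natrX exprS /=.
  by field; rewrite expf_neq0 ?pnatr_eq0 -?lt0n ?fact_gt0 //= addrC natr1 pnatr_eq0.
under eq_fun => n do rewrite -invf_div -[X in 'C(X, _)]subn0.
by apply: cvgV => //; exact: cvg_ratio_bin.
Qed.

Lemma cvg_deviation_rate : deviation_rate R r n @[n --> \oo] --> (0 : R).
Proof.
have inv0 : (n%:R^-1 : R) @[n --> \oo] --> (0 : R).
  by rewrite -cvg_shiftS; exact: cvg_harmonic.
(* Both binomials, scaled by [n ^ r], have the same nonzero limit, so their ratio tends to 1. *)
have lim : (('C(r * n - 0, r)%:R / n%:R ^+ r) * ('C(r * n - r, r)%:R / n%:R ^+ r)^-1
      - 1 + n%:R^-1 : R) @[n --> \oo]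
    --> ((r%:R ^+ r / r`!%:R) * (r%:R ^+ r / r`!%:R)^-1 - 1 + 0 : R).
  apply: cvgD inv0; apply: cvgB; last exact: cvg_cst.
  by apply: cvgM; [exact: cvg_ratio_bin | apply: cvgV; last exact: cvg_ratio_bin].
rewrite mulfV // subrr addr0 in lim; apply: cvg_trans lim; apply: near_eq_cvg.
near=> n; have n_neq0 : n%:R ^+ r != 0 :> R.
  by rewrite expf_neq0 // pnatr_eq0 -lt0n; near: n; exact: nbhs_infty_gt.
by rewrite /deviation_rate subn0 invf_div mulrA divfK.
Unshelve. all: by end_near. Qed.

End Limits.

(** * Union bound over finitely many cuts *)

Section Deviation.
Variables (R : realType) (r n K : nat) (c d : R).
Hypotheses (n_gt1 : (1 < n)%N) (K_gt0 : (0 < K)%N) (d_gt0 : 0 < d).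
Hypothesis near_c : `|n%:R ^+ r.+1 / 'C(r.+1 * n, r.+1)%:R - c| <= d.
Hypotheses (small_rK : r%:R / K%:R <= d) (small_rn : r%:R / n%:R <= d).

(** Since [L] exceeds [n / K], the product [Q * L] exceeds the number of vertices, and every
    threshold rounds down to one of [Q] multiples of [L]. *)
Notation Q := (r.+1 * K)%N.
Notation L := (n %/ K).+1.

(* [None] is the balanced cut, used for the lower bound; the grid cuts [Some q]
   serve for the upper bound, and their number does not depend on [n]. *)
Definition cut_coloring (o : option {ffun 'I_r -> 'I_Q}) : 'I_(r.+1 * n) -> 'I_r.+1 :=
  if o is Some q then threshold_coloring (fun i => q i * L)%N else @block_coloring r n.

Definition deviating (o : option {ffun 'I_r -> 'I_Q}) :=
  [set M in matchings r.+1 n |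
     d * n%:R < `|#|M :&: transversals (cut_coloring o)|%:R
                  - #|transversals (cut_coloring o)|%:R * n%:R
                    / 'C(r.+1 * n, r.+1)%:R|]%SET.

(** Of the budget [4 * d], one [d] pays for the deviation at a cut and one for the density being
    within [d] of [c]. The upper bound spends two more on the rounding loss [r * L], split as
    [r * (n %/ K)] and [r]. *)
Lemma sub_deviating :
  [set M in matchings r.+1 n |
     4 * d < `|(zP (rpartite_pattern r.+1) M)%:R / n%:R - c|]%SET
  \subset (\bigcup_o deviating o)%SET.
Proof.
have n_gt0 : 0 < n%:R :> R by rewrite ltr0n ltnW.
have B_gt0 : 0 < 'C(r.+1 * n, r.+1)%:R :> R by rewrite ltr0n bin_gt0 leq_pmulr // ltnW.
have K_gt0' : 0 < K%:R :> R by rewrite ltr0n.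
apply/fintype.subsetP => M; rewrite inE => /andP[MM]; apply: contraTT => notin.
have dev o : `|#|M :&: transversals (cut_coloring o)|%:R
    - #|transversals (cut_coloring o)|%:R * n%:R / 'C(r.+1 * n, r.+1)%:R| <= d * n%:R :> R.
  rewrite leNgt; apply: contra notin => lt_d; apply/finset.bigcupP; exists o => //.
  by rewrite inE MM.
pose a : R := n%:R ^+ r.+1 / 'C(r.+1 * n, r.+1)%:R.
have mean_le o : #|transversals (cut_coloring o)|%:R * n%:R / 'C(r.+1 * n, r.+1)%:R
    <= a * n%:R :> R.
  rewrite /a mulrAC ler_wpM2r ?ler0n // ler_pM2r ?invr_gt0 // -natrX ler_nat.
  exact: leq_card_transversals.
rewrite -leNgt ler_distl !lerBlDr ler_pdivrMr //.
rewrite -lerBlDr ler_pdivlMr //.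
have := near_c; rewrite -/a ler_distl => /andP[a_ge a_le].
have {}a_ge := ler_wpM2r (ltW n_gt0) a_ge; have {}a_le := ler_wpM2r (ltW n_gt0) a_le.
apply/andP; split.
  have := dev None; rewrite /= card_block_transversals natrX mulrAC -/a ler_distl.
  have : #|M :&: transversals (@block_coloring r n)|%:R
      <= (zP (rpartite_pattern r.+1) M)%:R :> R.
    rewrite ler_nat; apply: card_transversals_leq_zP (matching_trivIset MM) _.
    by move=> x y; exact: leq_div2r.
  move=> le_z /andP[ge_X _]; nra.
have [|q le_z] := @zP_leq_grid r n Q L M MM isT.
  by rewrite -mulnA ltn_pmul2l // mulnC ltn_ceil.
have := dev (Some q); rewrite /= ler_distl => /andP[_ le_X].
move: le_z; rewrite -(ler_nat R) natrD natrM -natr1 => le_z.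
have := mean_le (Some q); rewrite /= => le_mu.
have le_L : (n %/ K)%:R <= n%:R / K%:R :> R.
  by rewrite ler_pdivlMr // -natrM ler_nat leq_divM.
have le1 : r%:R * (n %/ K)%:R <= d * n%:R :> R.
  apply: le_trans (ler_wpM2l (ler0n _ _) le_L) _.
  by rewrite mulrCA mulrC ler_wpM2r // ltW.
have le2 : r%:R <= d * n%:R :> R by rewrite -ler_pdivrMr.
nra.
Qed.

(** Union bound over the cuts, with [card_deviation] for each. *)
Lemma card_far_from_density :
  #|[set M in matchings r.+1 n |
     4 * d < `|(zP (rpartite_pattern r.+1) M)%:R / n%:R - c|]%SET|%:R
  <= (#|{: option {ffun 'I_r -> 'I_Q}}|%:R * (deviation_rate R r.+1 n / d ^+ 2))
     * #|matchings r.+1 n|%:R.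
Proof.
apply: (@le_trans _ _ (\sum_o #|deviating o|%:R)).
  rewrite -natr_sum ler_nat; apply: leq_trans (leq_card_bigcup _).
  exact/subset_leq_card/sub_deviating.
rewrite -mulrA mulr_natl -sumr_const; apply: ler_sum => o _.
rewrite [leRHS]mulrC; apply: card_deviation => //.
exact: transversals_rsets.
Qed.

End Deviation.

(* Convergence in probability under the uniform distribution on
   matchings r n: for every eps > 0, P(|z/n - c| > eps) -> 0. *)
Theorem theorem2p1 (R : realType) (r : nat) (hr : (2 <= r)%N) (eps : R) (heps : 0 < eps) :
  (fun n : nat =>
     (#|[set M in matchings r n |
          eps < `| (zP (rpartite_pattern r) M)%:R / n%:R
                   - ((r.-1)`!)%:R / (r ^ r.-1)%:R |]|%:R
      / #|matchings r n|%:R : R)) @ \oo --> 0.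
Proof.
case: r hr => [//|r] hr.
set c : R := (r.+1.-1)`!%:R / (r.+1 ^ r.+1.-1)%:R.
pose d := eps / 4; have d_gt0 : 0 < d by rewrite divr_gt0.
have epsE : eps = 4 * d by rewrite /d; field.
(* This [K] exceeds [r / d], so [r / k <= d] for every [k >= K]: both for [K] itself and for all
   large [n]. *)
pose K := (Num.truncn (r%:R / d)).+1.
pose C : R := #|{: option {ffun 'I_r -> 'I_(r.+1 * K)}}|%:R.
have lim : C * (deviation_rate R r.+1 n / d ^+ 2) @[n --> \oo] --> (0 : R).
  rewrite -(mulr0 C) -[X in C * X](mul0r (d ^+ 2)^-1).
  apply: cvgM; first exact: cvg_cst.
  by apply: cvgM; [exact: cvg_deviation_rate | exact: cvg_cst].
have near_density :
    \forall n \near \oo, `|n%:R ^+ r.+1 / 'C(r.+1 * n, r.+1)%:R - c| <= d.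
  by have /cvgrPdistC_le/(_ d d_gt0) := @cvg_density R r.+1 (ltn0Sn r).
apply: (squeeze_cvgr _ (cvg_cst _) lim); near=> n.
rewrite divr_ge0 ?ler0n //=.
have n_gt1 : (1 < n)%N by near: n; exact: nbhs_infty_gt.
have n_gt0 : 0 < n%:R :> R by rewrite ltr0n ltnW.
have small (k : nat) : (K <= k)%N -> r%:R / k%:R <= d.
  move=> le_Kk; have k_gt0 : 0 < k%:R :> R by rewrite ltr0n (leq_trans _ le_Kk).
  rewrite ler_pdivrMr // mulrC -ler_pdivrMr //.
  apply: le_trans (_ : K%:R <= _); last by rewrite ler_nat.
  by rewrite ltW // truncnS_gt.
have near_c : `|n%:R ^+ r.+1 / 'C(r.+1 * n, r.+1)%:R - c| <= d.
  near: n; exact: near_density.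
have smallK := small K (leqnn K).
have small_n : r%:R / n%:R <= d by apply: small; near: n; exact: nbhs_infty_ge.
have := card_far_from_density n_gt1 (ltn0Sn _) d_gt0 near_c smallK small_n.
(* With no matchings the quotient is 0 by the convention on division by zero, so nonnegativity of
   the bound suffices. *)
rewrite -epsE; have [m0|m_gt0] := posnP #|matchings r.+1 n|.
  rewrite m0 invr0 !mulr0 => _.
  by rewrite mulr_ge0 ?ler0n // divr_ge0 ?exprn_ge0 ?deviation_rate_ge0 // ltW.
by rewrite ler_pdivrMr // ltr0n.
Unshelve. all: by end_near. Qed.
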